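(* The vectors $(u,0)$ with $u\in\mathscr H_0$ are exactly the linear span of all eigenvectors of $J$ supported entirely in the finite core. Relative to the decomposition $\mathbb C^d=\mathscr H_0\oplus\mathscr H_0^\perp$, $$F(\zeta)=\bigl(H_0-x(\zeta)I\bigr)\oplus F_{\mathrm{coupled}}(\zeta),\qquad F_{\mathrm{coupled}}(\zeta)=H_{\mathrm{coupled}}-x(\zeta)I+\frac{\zeta^{-1}}aV_{\mathrm{coupled}}V_{\mathrm{coupled}}^* .$$ Hence $$\det S(\zeta)=(-1)^r\frac{\det F_{\mathrm{coupled}}(\zeta^{-1})}{\det F_{\mathrm{coupled}}(\zeta)} .$$ In particular, every core-supported eigenvalue contributes to $\det F(\zeta)$ through the factor $\det(H_0-x(\zeta)I)$, which is invariant under $\zeta\mapsto\zeta^{-1}$, and that factor cancels identically from the scattering determinant $\det S$.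
   Context: Let $q$ be a prime power, $a=\sqrt q$, $d,r\ge1$ integers, $H_C=H_C^*$ a complex $d\times d$ matrix, and $V:\mathbb C^r\to\mathbb C^d$ linear. Let $\mathscr H=\mathbb C^d\oplus\bigoplus_{c=1}^r\ell^2(\mathbb N)$, $\mathbb N=\{1,2,\dots\}$; write elements as $(u,g)$ with $g(n)\in\mathbb C^r$; the summand $\mathbb C^d$ is the finite core. The bounded self-adjoint operator $J$ is $J(u,g)=(H_Cu+Vg(1),\,h)$, where $h(1)=a\,g(2)+V^*u$ and $h(n)=a\{g(n-1)+g(n+1)\}$ for $n\ge2$. For $\zeta\in\mathbb C^\times$ put $x(\zeta)=a(\zeta+\zeta^{-1})$, $$F(\zeta)=H_C-x(\zeta)I_d+\frac{\zeta^{-1}}{a}VV^*,\qquad S(\zeta)=-I_r+\frac{\zeta^{-1}-\zeta}{a}V^*F(\zeta)^{-1}V$$ (the identity for $\det S$ is one of meromorphic functions). $\mathscr H_0$ is the largest $H_C$-invariant subspace contained in $\ker V^*$. Since $H_C$ is Hermitian, $\mathscr H_0$ reduces $H_C$; write $H_C=H_0\oplus H_{\mathrm{coupled}}$ on $\mathbb C^d=\mathscr H_0\oplus\mathscr H_0^\perp$. Since $\operatorname{ran}V\subset\mathscr H_0^\perp$, let $V_{\mathrm{coupled}}:\mathbb C^r\to\mathscr H_0^\perp$ be $V$ with restricted codomain. Determinants on the zero space equal $1$. *)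

(* Defs.v *)
From HB Require Import structures.
From mathcomp Require Export all_boot all_order all_algebra.
From mathcomp Require Export complex.
From mathcomp Require Export all_classical all_reals all_analysis.

Set Implicit Arguments.
Unset Strict Implicit.
Unset Printing Implicit Defensive.

Import Order.TTheory GRing.Theory Num.Theory.
Import passmx numFieldNormedType.Exports.

Local Open Scope ring_scope.
Local Open Scope classical_set_scope.
Local Open Scope sesquilinear_scope.

Definition prime_power (q : nat) : Prop :=
  exists p k : nat, [/\ prime p, (0 < k)%N & q = (p ^ k)%N].

Section LinearAlgebra.
Variable C : numClosedFieldType.

(* lfdetE: the choice of basis is irrelevant.  The value is 1 on the zero space. *)
Definition lfdet (vT : vectType C) (f : 'End(vT)) : C :=
  \det (mxof (vbasis {:vT}) (vbasis {:vT}) f).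

Lemma lfdetE (vT : vectType C) (e : (\dim {:vT}).-tuple vT) (f : 'End(vT)) :
  basis_of {:vT} e -> lfdet f = \det (mxof e e f).
Proof.
set b := vbasis {:vT} => eB; have bB : basis_of {:vT} b by exact: vbasisP.
have fE : f = (\1 \o (f \o \1))%VF by rewrite comp_lfun1l comp_lfun1r.
rewrite [in RHS]fE (mxof_comp _ _ bB) (mxof_comp _ _ bB) !det_mulmx.
rewrite mulrAC -det_mulmx -(mxof_comp _ _ bB) comp_lfun1l.
by rewrite mxof1 ?det1 ?mul1r // (basis_free eB).
Qed.

Definition is_linspan_of (vT : lmodType C) (A : set vT) (v : vT) : Prop :=
  exists (n : nat) (c : 'I_n -> C) (w : 'I_n -> vT),
    (forall i, A (w i)) /\ v = \sum_(i < n) c i *: w i.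

Definition linspan (vT : lmodType C) (A : set vT) : set vT :=
  [set v | is_linspan_of A v].

Section Subspaces.
Variable d : nat.
Implicit Types U W : {vspace 'cV[C]_d}.

Definition invariant (A : 'M[C]_d) U : Prop :=
  forall u, u \in U -> A *m u \in U.

Definition orthov U : {vspace 'cV[C]_d} :=
  lker (linfun (mulmx (\matrix_(i < \dim U, j < d) ((vbasis U)`_i j 0)^*))).

Lemma orthovP U y :
  reflect (forall u, u \in U -> u^t* *m y = 0) (y \in orthov U).
Proof.
rewrite memv_ker lfunE /=; apply: (iffP eqP) => [y0 u uU|yU].
- rewrite (coord_vbasis uU) linear_sum /= map_mx_sum mulmx_suml big1 // => i _.
  rewrite linearZ /= map_mxZ -scalemxAl; apply/eqP.
  rewrite scaler_eq0; apply/orP; right; apply/eqP/matrixP => j k.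
  move/matrixP/(_ i k): y0; rewrite !ord1 !mxE => y0; rewrite -[RHS]y0.
  by apply: eq_bigr => l _; rewrite !mxE.
- apply/matrixP => i k; rewrite ord1 mxE.
  have /yU/matrixP/(_ 0 0) : (vbasis U)`_i \in U.
    by apply: vbasis_mem; rewrite mem_nth // size_tuple.
  by rewrite !mxE => h; rewrite -[RHS]h; apply: eq_bigr => l _; rewrite !mxE.
Qed.

Lemma capv_orthov U : (U :&: orthov U = 0)%VS.
Proof.
apply/eqP; rewrite -subv0; apply/subvP => u; rewrite memv_cap memv0.
case/andP => uU /orthovP/(_ u uU)/matrixP/(_ 0 0).
rewrite !mxE => u0; apply/eqP/matrixP => i j; rewrite ord1 mxE.
have /psumr_eq0P : forall k : 'I_d, true -> 0 <= (u k 0)^* * u k 0.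
  by move=> k _; rewrite mulrC mul_conjC_ge0.
have u1 : \sum_(k < d) (u k 0)^* * u k 0 = 0.
  by rewrite -[RHS]u0; apply: eq_bigr => k _; rewrite !mxE.
by move=> /(_ u1 i erefl)/eqP; rewrite mulrC mul_conjC_eq0 => /eqP.
Qed.

Lemma addv_orthov U : (U + orthov U = fullv)%VS.
Proof.
apply/eqP; rewrite eqEdim subvf /=.
rewrite dimv_disjoint_sum ?capv_orthov //.
rewrite -(limg_ker_dim (linfun (mulmx (\matrix_(i < \dim U, j < d)
   ((vbasis U)`_i j 0)^*))) fullv) capfv addnC leq_add2r.
by apply: (leq_trans (dimvS (subvf _))); rewrite dimvf /dim /= muln1.
Qed.

Lemma orthov_invariant (A : 'M[C]_d) U :
  A^t* = A -> invariant A U -> invariant A (orthov U).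
Proof.
move=> hA iA y /orthovP yU; apply/orthovP => u uU.
by rewrite mulmxA -{1}hA -map_mxM -trmx_mul yU // iA.
Qed.

(* vsproj U is a projection onto U along an unspecified complement; on the
   vectors where it is used below it acts as the identity: see restr_endE and
   restr_codE. *)
Definition restr_end (A : 'M[C]_d) U : 'End(subvs_of U) :=
  linfun (vsproj U \o mulmx A \o vsval).

Lemma restr_endE (A : 'M[C]_d) U (u : subvs_of U) :
  invariant A U -> vsval (restr_end A U u) = A *m vsval u.
Proof.
by move=> iA; rewrite lfunE /= vsprojK // iA // subvsP.
Qed.

Definition restr_cod r (B : 'M[C]_(d, r)) U : 'Hom('cV[C]_r, subvs_of U) :=
  linfun (vsproj U \o mulmx B).

Lemma restr_codE r (B : 'M[C]_(d, r)) U (w : 'cV[C]_r) :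
  (forall w', B *m w' \in U) -> vsval (restr_cod B U w) = B *m w.
Proof.
by move=> h; rewrite lfunE /= vsprojK.
Qed.

(* The i-th coordinate of f^* y is <f e_i, y>, for the inner product which U
   inherits from C^d (antilinear in its first argument). *)
Definition adj_fun U r (f : 'Hom('cV[C]_r, subvs_of U)) (y : subvs_of U) :
    'cV[C]_r :=
  \col_i ((vsval (f (delta_mx i 0)))^t* *m vsval y) 0 0.

Lemma adj_fun_is_linear U r (f : 'Hom('cV[C]_r, subvs_of U)) :
  linear (adj_fun f).
Proof.
move=> c y z; apply/matrixP => i j; rewrite !mxE mulr_sumr -big_split /=.
by apply: eq_bigr => k _; rewrite !mxE mulrDr mulrCA.
Qed.

HB.instance Definition _ U r (f : 'Hom('cV[C]_r, subvs_of U)) :=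
  GRing.isSemilinear.Build C _ _ _ (adj_fun f)
    (GRing.semilinear_linear (adj_fun_is_linear f)).

Definition adjoint U r (f : 'Hom('cV[C]_r, subvs_of U)) :
    'Hom(subvs_of U, 'cV[C]_r) :=
  linfun (adj_fun f).

Lemma adjointP U r (f : 'Hom('cV[C]_r, subvs_of U)) w y :
  (vsval (f w))^t* *m vsval y = w^t* *m adjoint f y.
Proof.
rewrite lfunE /=; apply/matrixP => i j; rewrite !ord1.
have {1}-> : w = \sum_k w k 0 *: delta_mx k 0.
  by rewrite {1}[w]matrix_sum_delta; apply: eq_bigr => k _; rewrite big_ord1.
rewrite !linear_sum /= map_mx_sum mulmx_suml summxE mxE.
apply: eq_bigr => k _; rewrite !linearZ /= map_mxZ -scalemxAl.
by rewrite /adj_fun !mxE.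
Qed.

Section Uncoupled.
Variables (r : nat) (HC : 'M[C]_d) (V : 'M[C]_(d, r)).

Definition inv_in_ker U : Prop :=
  invariant HC U /\ (forall u, u \in U -> V^t* *m u = 0).

Definition is_largest_inv_in_ker U : Prop :=
  inv_in_ker U /\ (forall W, inv_in_ker W -> (W <= U)%VS).

Lemma largest_inv_in_ker_exists : exists U, is_largest_inv_in_ker U.
Proof.
pose p n := `[< exists U, inv_in_ker U /\ \dim U = n >].
have p0 : exists n, p n.
  exists 0%N; apply/asboolP; exists 0%VS; rewrite dimv0; split=> //.
  by split=> u; rewrite memv0 => /eqP ->; rewrite mulmx0 ?mem0v.
have pd n : p n -> (n <= \dim {:'cV[C]_d})%N.
  by move=> /asboolP [U [_ <-]]; exact/dimvS/subvf.
case: (ex_maxnP p0 pd) => n /asboolP [U [[iU kU] dU]] maxn.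
exists U; split=> // W [iW kW].
have sUW : inv_in_ker (U + W)%VS.
  split=> _ /memv_addP [u uU [w wW ->]]; rewrite mulmxDr.
    by rewrite memv_add ?iU ?iW.
  by rewrite kU // kW // addr0.
apply: (subv_trans (addvSr U W)).
rewrite -(geq_leqif (dimv_leqif_sup (addvSl U W))) dU; apply: maxn.
by apply/asboolP; exists (U + W)%VS.
Qed.

Definition uncoupled : {vspace 'cV[C]_d} :=
  sval (cid largest_inv_in_ker_exists).

Lemma uncoupledP : is_largest_inv_in_ker uncoupled.
Proof. exact: svalP (cid largest_inv_in_ker_exists). Qed.

Lemma ran_sub_orthov_uncoupled (w : 'cV[C]_r) : V *m w \in orthov uncoupled.
Proof.
apply/orthovP => u uU; have [[_ kU] _] := uncoupledP.
have -> : u^t* *m (V *m w) = (V^t* *m u)^t* *m w.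
  by rewrite trmx_mul map_mxM trmxCK mulmxA.
by rewrite kU // trmx0 map_mx0 mul0mx.
Qed.

Definition H_0 : 'End(subvs_of uncoupled) := restr_end HC uncoupled.

Definition H_coupled : 'End(subvs_of (orthov uncoupled)) :=
  restr_end HC (orthov uncoupled).

Definition V_coupled : 'Hom('cV[C]_r, subvs_of (orthov uncoupled)) :=
  restr_cod V (orthov uncoupled).

End Uncoupled.
End Subspaces.
End LinearAlgebra.

Section Model.
Local Open Scope complex_scope.
Variables (R : realType) (q d r : nat).
Variables (HC : 'M[R[i]]_d) (V : 'M[R[i]]_(d, r)).
Implicit Types (zeta lambda : R[i]).

Definition hop : R[i] := (Num.sqrt (q%:R : R))%:C.

Definition xmap zeta : R[i] := hop * (zeta + zeta^-1).

Definition Fmat zeta : 'M[R[i]]_d :=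
  HC - (xmap zeta)%:M + (zeta^-1 / hop) *: (V *m V^t*).

Definition Smat zeta : 'M[R[i]]_r :=
  - 1%:M + ((zeta^-1 - zeta) / hop) *: (V^t* *m invmx (Fmat zeta) *m V).

Definition H_0_minus zeta : 'End(subvs_of (uncoupled HC V)) :=
  H_0 HC V - xmap zeta *: \1%VF.

Definition F_coupled zeta : 'End(subvs_of (orthov (uncoupled HC V))) :=
  H_coupled HC V - xmap zeta *: \1%VF
  + (zeta^-1 / hop) *: (V_coupled HC V \o adjoint (V_coupled HC V))%VF.

(* A pair (u, g) with g indexed from 0, so that g n stands for g(n+1). *)
Local Notation ambient := ('cV[R[i]]_d * (nat -> 'cV[R[i]]_r))%type.

Definition hilbert : set ambient :=
  [set psi : ambient | forall c : 'I_r, cvgn (series (fun n => complex.Re `|psi.2 n c 0| ^+ 2))].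

Definition J (psi : ambient) : ambient :=
  (HC *m psi.1 + V *m psi.2 0%N,
   fun n => if n is m.+1 then hop *: (psi.2 m + psi.2 m.+2)
            else hop *: psi.2 1%N + V^t* *m psi.1).

Definition eigenvector_for lambda : set ambient :=
  [set psi | [/\ hilbert psi, psi != 0 & J psi = lambda *: psi]].

Definition core_supported : set ambient := [set psi | psi.2 = 0].

Definition core_eigenvectors : set ambient :=
  [set psi | (exists lambda, eigenvector_for lambda psi) /\ core_supported psi].

Definition core_eigenvalue lambda : Prop :=
  exists psi, eigenvector_for lambda psi /\ core_supported psi.

End Model.

(* Main.v *)
(** The space [H_0] and its orthogonal complement are both [HC]-invariant and
    the image of [V] lies in the complement, so [F] is block diagonal and its
    determinant factors; the [H_0] factor depends on [zeta] only through
    [x(zeta) = x(zeta^-1)].  Sylvester's identity [det(1 + AB) = det(1 + BA)]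
    and [F(zeta^-1) = F(zeta) - (zeta^-1 - zeta)/a V V^*] give
    [det S = (-1)^r det F(zeta^-1) / det F(zeta)], where the [H_0] factors
    cancel.  A vector [(u, 0)] is an eigenvector of [J] exactly when [u] is an
    eigenvector of [HC] in [ker V^*], hence in [H_0], and [H_0] is spanned by
    such [u] because [HC] is Hermitian. *)

From mathcomp Require Import spectral.
Require Import Defs.

Set Implicit Arguments.
Unset Strict Implicit.
Unset Printing Implicit Defensive.

Import Order.TTheory GRing.Theory Num.Theory.
Import passmx numFieldNormedType.Exports.

Local Open Scope classical_set_scope.
Local Open Scope ring_scope.
Local Open Scope complex_scope.
Local Open Scope sesquilinear_scope.

(** * Determinants and eigenvectors on subspaces *)

Lemma linspan_cons (C : numClosedFieldType) (vT : lmodType C) (A : set vT)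
    c v w :
  A v -> linspan A w -> linspan A (c *: v + w).
Proof.
move=> Av [n [k [e [Ae ->]]]].
exists n.+1, (fun i => oapp k c (unlift ord0 i)),
  (fun i => oapp e v (unlift ord0 i)); split.
  by move=> i; case: unliftP => [j|] _ /=.
rewrite big_ord_recl unlift_none; congr (_ + _).
by apply: eq_bigr => i _; rewrite !liftK.
Qed.

Section LinearAlgebra.
Variable C : numClosedFieldType.

(** [mxof] acts on row vectors from the right, so the left kernel provided by [det0P] is the kernel
    of [f] in coordinates. *)
Lemma lfdet_eq0P (vT : vectType C) (f : 'End(vT)) :
  reflect (exists2 v, v != 0 & f v = 0) (lfdet f == 0).
Proof.
have bP := vbasisP {:vT}; apply: (iffP det0P) => -[v v0 fv].
  exists (vecof (vbasis {:vT}) v); first by rewrite vecof_eq0.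
  by rewrite (hom_vecof _ bP) fv linear0.
exists (rVof (vbasis {:vT}) v); first by rewrite rVof_eq0.
by rewrite -(rVof_app _ bP) fv linear0.
Qed.

Lemma lfun_eigenvector (vT : vectType C) (f : 'End(vT)) :
  (0 < \dim {:vT})%N -> exists l, exists2 v, v != 0 & f v = l *: v.
Proof.
move=> n_gt0; have bP := vbasisP {:vT}.
have [l /eigenvalueP[v fv v0]] :=
  eigenvalue_closed (mxof (vbasis {:vT}) (vbasis {:vT}) f) n_gt0.
exists l, (vecof (vbasis {:vT}) v); first by rewrite vecof_eq0.
by rewrite (hom_vecof _ bP) fv linearZ.
Qed.

(** Similar matrices have equal determinants. The sizes are kept apart because stacked bases of two
    subspaces have [d] rows only up to a propositional equality. *)
Lemma det_conj_row_free (m d : nat) (B : 'M[C]_(m, d))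
    (M : 'M[C]_m) (A : 'M[C]_d) :
  m = d -> row_free B -> B *m A = M *m B -> \det A = \det M.
Proof.
move=> e; case: _ / e in A B * => /row_freeP[B' /mulmx1C BB'] BA.
rewrite -[A]mul1mx -BB' -mulmxA BA !det_mulmx mulrCA -det_mulmx BB'.
by rewrite det1 mulr1.
Qed.

Variable d : nat.
Implicit Types (U W : {vspace 'cV[C]_d}) (A : 'M[C]_d).

(** The basis vectors are laid out as rows to match the row convention of [mxof]; this is why [A^T]
    replaces [A] below. *)
Definition basis_rows U : 'M[C]_(\dim {:subvs_of U}, d) :=
  \matrix_(i, j) vsval (vbasis {:subvs_of U})`_i j 0.

Lemma mul_basis_rows U (x : 'rV_(\dim {:subvs_of U})) :
  x *m basis_rows U = (vsval (vecof (vbasis {:subvs_of U}) x))^T.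
Proof.
apply/rowP => j; rewrite /vecof linear_sum !mxE summxE.
by apply: eq_bigr => i _; rewrite linearZ !mxE.
Qed.

Lemma basis_rows_mul U (A : 'M[C]_d) (f : 'End(subvs_of U)) :
  (forall u, vsval (f u) = A *m vsval u) ->
  basis_rows U *m A^T =
    mxof (vbasis {:subvs_of U}) (vbasis {:subvs_of U}) f *m basis_rows U.
Proof.
move=> fA; have bP := vbasisP {:subvs_of U}.
apply/row_matrixP => i; rewrite !row_mul !rowE !mul_basis_rows mul_mxof rVofK //.
by rewrite fA trmx_mul.
Qed.

(** Stacking bases of [U] and [W] gives a basis of the whole space, in which [A^T] is block diagonal
    with blocks the matrices of [f] and [g]. *)
Lemma det_direct_sum U W (A : 'M[C]_d)
    (f : 'End(subvs_of U)) (g : 'End(subvs_of W)) :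
  (U :&: W = 0)%VS -> (U + W = fullv)%VS ->
  (forall u, vsval (f u) = A *m vsval u) ->
  (forall w, vsval (g w) = A *m vsval w) ->
  \det A = lfdet f * lfdet g.
Proof.
move=> UW0 UWT fA gA; rewrite -det_tr -(det_ublock _ 0).
apply: (@det_conj_row_free _ _ (col_mx (basis_rows U) (basis_rows W))).
- rewrite !dimvf /= -[dim (subvs_of U)]/(\dim U) -[dim (subvs_of W)]/(\dim W).
  by rewrite -dimv_disjoint_sum // UWT dimvf /dim /= muln1.
- apply: inj_row_free => v; rewrite -[v]hsubmxK mul_row_col !mul_basis_rows.
  (* A linear relation between the rows makes [a] the opposite of [b], a vector common to [U] and
     [W], hence zero. *)
  set a := vecof _ _; set b := vecof _ _ => /(canRL (addrK _)).
  rewrite sub0r -linearN => /trmx_inj ab.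
  have /eqP a0 : vsval a == 0.
    by rewrite -memv0 -UW0 memv_cap subvsP /= ab memvN subvsP.
  have /eqP b0 : vsval b == 0 by rewrite -oppr_eq0 -ab a0.
  have /eqP : a == 0 by apply/eqP/subvs_inj.
  have /eqP : b == 0 by apply/eqP/subvs_inj.
  move=> /eqP; rewrite vecof_eq0 ?vbasisP // => /eqP ->.
  by move=> /eqP; rewrite vecof_eq0 ?vbasisP // => /eqP ->; rewrite row_mx0.
- rewrite mul_col_mx mul_block_col !mul0mx addr0 add0r.
  by rewrite (basis_rows_mul fA) (basis_rows_mul gA).
Qed.

(* Split off one eigenvector [v] in [U] and recurse on the orthogonal complement
   of [v] in [U]. *)
Lemma hermitian_eigenspan A U u : A^t* = A -> invariant A U -> u \in U ->
  linspan [set w | [/\ w \in U, w != 0 & exists l, A *m w = l *: w]] u.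
Proof.
move=> hA; have [n] := ubnP (\dim U); elim: n U u => // n IH U u dU iU uU.
have [/eqP|U_gt0] := posnP (\dim U).
  rewrite dimv_eq0 => /eqP U0; move: uU; rewrite U0 memv0 => /eqP ->.
  by exists 0%N, (fun=> 0), (fun=> 0); split=> [[]|] //; rewrite big_ord0.
have [|l [v v0 /(congr1 vsval)]] :=
  @lfun_eigenvector _ (restr_end A U).
  by rewrite dimvf.
rewrite restr_endE // linearZ /= => Av.
have {}v0 : vsval v != 0 by [].
have vU := subvsP v; move: (vsval v) v0 vU Av => {}v v0 vU Av.
have /memv_addP[_ /vlineP[k ->] [y yv ukv]] : u \in (<[v]> + orthov <[v]>)%VS.
  by rewrite addv_orthov memvf.
rewrite ukv; apply: linspan_cons; first by split=> //; exists l.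
have yU : y \in U.
  by rewrite -[y](addKr (k *: v)) -ukv addrC memvB // memvZ.
have iv : invariant A <[v]>%VS.
  by move=> _ /vlineP[c ->]; rewrite -scalemxAr Av !memvZ ?memv_line.
have [|||m [c [w [wP ->]]]] := IH (U :&: orthov <[v]>)%VS y.
- rewrite ltnS in dU; apply: leq_trans dU.
  rewrite ltn_neqAle dimvS ?capvSl // andbT.
  (* Without a drop in dimension, [v] would be orthogonal to itself. *)
  apply: contraNneq v0 => /eqP; rewrite (dimv_leqif_eq (capvSl _ _)) => /eqP UE.
  have : v \in (<[v]> :&: orthov <[v]>)%VS.
    by move: vU; rewrite -UE !memv_cap memv_line => /andP[].
  by rewrite capv_orthov memv0.
- move=> z; rewrite !memv_cap => /andP[zU zv].
  by rewrite iU //= (orthov_invariant hA iv).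
- by rewrite memv_cap yU.
- exists m, c, w; split=> // i; have [] := wP i.
  by rewrite memv_cap => /andP[].
Qed.

End LinearAlgebra.

(** Both sides equal the determinant of the block matrix with rows [1, - A] and [B, 1], eliminated
    along either diagonal block. *)
Lemma det_add1_mulmxC (K : comNzRingType) (m n : nat)
    (A : 'M[K]_(m, n)) (B : 'M[K]_(n, m)) :
  \det (1%:M + A *m B) = \det (1%:M + B *m A).
Proof.
have -> : \det (1%:M + B *m A) = \det (block_mx 1%:M (- A) B 1%:M).
  have -> : block_mx 1%:M (- A) B 1%:M =
      block_mx 1%:M 0 B 1%:M *m block_mx 1%:M (- A) 0 (1%:M + B *m A).
    rewrite mulmx_block !mul1mx !mul0mx !mulmx1 !addr0 mulmxN addrCA.
    by rewrite addNr addr0.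
  by rewrite det_mulmx det_lblock det_ublock !det1 !mul1r.
have -> : block_mx 1%:M (- A) B 1%:M =
    block_mx 1%:M (- A) 0 1%:M *m block_mx (1%:M + A *m B) 0 B 1%:M.
  by rewrite mulmx_block !mul1mx !mul0mx !mulmx1 !add0r mulNmx addrK.
by rewrite det_mulmx det_lblock det_ublock !det1 !mul1r mulr1.
Qed.

(** * Block form of [Fmat], the scattering determinant, and core-supported eigenvectors *)

Section Model.
Variables (R : realType) (q d r : nat) (HC : 'M[R[i]]_d) (V : 'M[R[i]]_(d, r)).

Lemma hop_neq0 : prime_power q -> hop R q != 0.
Proof.
move=> [p [k [p_prime _ ->]]]; rewrite /hop fmorph_eq0 sqrtr_eq0 -ltNge ltr0n.
by rewrite expn_gt0 prime_gt0.
Qed.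

Lemma xmapV (zeta : R[i]) : xmap q zeta^-1 = xmap q zeta.
Proof. by rewrite /xmap invrK addrC. Qed.

(** The term in [V *m V^t*] vanishes because [V^t*] kills [uncoupled]. *)
Lemma H_0_minusE zeta u :
  vsval (H_0_minus q HC V zeta u) = Fmat q HC V zeta *m vsval u.
Proof.
have [[iU kU] _] := uncoupledP HC V.
rewrite /H_0_minus /H_0 add_lfunE opp_lfunE scale_lfunE id_lfunE.
rewrite linearB linearZ /= scalerN restr_endE //.
rewrite !mulmxDl mulNmx mul_scalar_mx -scalemxAl -mulmxA kU ?subvsP //.
by rewrite mulmx0 scaler0 addr0.
Qed.

(** Since [HC] is Hermitian, it also preserves the orthogonal complement, so the projections inside
    [restr_end] and [restr_cod] act as the identity. *)
Lemma F_coupledE zeta w : HC = HC^t* ->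
  vsval (F_coupled q HC V zeta w) = Fmat q HC V zeta *m vsval w.
Proof.
move=> hHC; have [[iU _] _] := uncoupledP HC V.
have iU' := orthov_invariant (esym hHC) iU.
rewrite /F_coupled /H_coupled /V_coupled !add_lfunE opp_lfunE.
rewrite !scale_lfunE id_lfunE comp_lfunE.
rewrite linearD linearB !linearZ /= scalerN restr_endE // restr_codE; last first.
  exact: ran_sub_orthov_uncoupled.
rewrite !mulmxDl mulNmx mul_scalar_mx -scalemxAl -mulmxA.
congr (_ + _ *: (_ *m _)).
(* The coordinates of the adjoint are inner products with the columns of [V], that is, the entries
   of [V^t* *m vsval w]. *)
apply/matrixP => i j; rewrite ord1 /adjoint lfunE /= mxE restr_codE; last first.
  exact: ran_sub_orthov_uncoupled.
by rewrite -colE !mxE; apply: eq_bigr => k _; rewrite !mxE.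
Qed.

Lemma det_Fmat zeta : HC = HC^t* ->
  \det (Fmat q HC V zeta) =
  lfdet (H_0_minus q HC V zeta) * lfdet (F_coupled q HC V zeta).
Proof.
move=> hHC; apply: det_direct_sum; first exact: capv_orthov.
- exact: addv_orthov.
- exact: H_0_minusE.
- by move=> w; exact: F_coupledE.
Qed.

Lemma det_Smat zeta : Fmat q HC V zeta \in unitmx ->
  \det (Smat q HC V zeta) =
  (-1) ^+ r * (\det (Fmat q HC V zeta^-1) / \det (Fmat q HC V zeta)).
Proof.
move=> uF; set c := (zeta^-1 - zeta) / hop R q.
have -> : Smat q HC V zeta =
    - 1 *: (1%:M + V^t* *m (- c *: (invmx (Fmat q HC V zeta) *m V))).
  by rewrite scaleN1r opprD -scalemxAr scaleNr opprK mulmxA.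
(* The scalar [- 1] yields the sign; moving [V^t*] to the right turns the determinant of size [r]
   into one of size [d], ready to be multiplied by [\det (Fmat q HC V zeta)]. *)
rewrite detZ det_add1_mulmxC; congr (_ * _).
have dF : \det (Fmat q HC V zeta) != 0 by rewrite -unitfE -unitmxE.
apply: (mulIf dF); rewrite divfK // mulrC -det_mulmx; congr (\det _).
rewrite mulmxDr mulmx1 -scalemxAl -scalemxAr !mulmxA mulmxV // mul1mx.
(* What remains is [zeta^-1 / a - c = zeta / a], with [a] for [hop R q]: the coefficient of
   [V *m V^t*] at [zeta^-1]. *)
rewrite /Fmat xmapV invrK -addrA -scalerDl; congr (_ + _ *: _).
by rewrite /c mulrBl opprB addrCA addrN addr0.
Qed.

(* The determinant of [zeta^-1 F(zeta)] is a polynomial in [zeta^-1] whose value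
   at [0] is [(- a) ^+ d]. *)
Lemma finite_singular_Fmat : hop R q != 0 ->
  finite_set [set zeta : R[i] | zeta != 0 /\ Fmat q HC V zeta \notin unitmx].
Proof.
move=> hop0.
pose M : 'M[{poly R[i]}]_d := 'X *: map_mx polyC HC
  - ((hop R q)%:P * ('X ^+ 2 + 1))%:M
  + 'X ^+ 2 *: map_mx polyC ((hop R q)^-1 *: (V *m V^t*)).
have ME z : (\det M).[z] = \det (z *: HC - (hop R q * (z ^+ 2 + 1))%:M
    + z ^+ 2 *: ((hop R q)^-1 *: (V *m V^t*))).
  rewrite -[LHS]/(horner_eval z (\det M)) -det_map_mx; congr (\det _).
  apply/matrixP => i j; rewrite !mxE /= /horner_eval.
  by rewrite !(hornerE, hornerMn, hornerXn).
have M0 : \det M != 0.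
  apply: contra_neq (hop0) => /(congr1 (horner^~ 0)); rewrite ME.
  rewrite expr0n /= !scale0r sub0r addr0 add0r mulr1 horner0 -raddfN det_scalar.
  by move/eqP; rewrite expf_eq0 oppr_eq0 => /andP[_ /eqP].
have [s detM] := closed_field_poly_normal (\det M).
apply: (sub_finite_set _ (finite_image GRing.inv (finite_seq s))) => z /= [z0].
rewrite unitmxE unitfE negbK => dF; exists z^-1; last by rewrite invrK.
have : root (\det M) z^-1.
  rewrite rootE ME; have -> :
    (z^-1 *: HC - (hop R q * (z^-1 ^+ 2 + 1))%:M
    + z^-1 ^+ 2 *: ((hop R q)^-1 *: (V *m V^t*))) = z^-1 *: Fmat q HC V z.
    rewrite /Fmat !scalerDr scalerN !scalerA scale_scalar_mx /xmap.
    congr (_ - _%:M + _ *: _); last by rewrite mulrA.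
    by rewrite mulrCA (mulrDr z^-1) mulVf // addrC.
  by rewrite detZ (eqP dF) mulr0.
by rewrite detM rootZ ?lead_coef_eq0 // root_prod_XsubC.
Qed.

Lemma core_eigenvectorE (lambda : R[i]) (u : 'cV[R[i]]_d) :
  eigenvector_for q HC V lambda (u, 0) <->
  [/\ u \in uncoupled HC V, u != 0 & HC *m u = lambda *: u].
Proof.
(* Index 0 is the first site of the leads, where the eigenvalue equation reads [V^t* *m u = 0]. The
   line spanned by [u] is then invariant and killed by [V^t*], so maximality of [uncoupled]
   applies. *)
split=> [[_ u0 [Hu /funeqP/(_ 0%N)]]|[uU u0 Hu]].
  rewrite /= !scaler0 add0r => Vu; split.
  - have [_ /(_ <[u]>%VS)] := uncoupledP HC V; rewrite -memvE; apply; split.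
      move=> _ /vlineP[c ->]; rewrite -scalemxAr.
      by move: Hu; rewrite /= mulmx0 addr0 => ->; rewrite !memvZ ?memv_line.
    by move=> _ /vlineP[c ->]; rewrite -scalemxAr Vu scaler0.
  - by apply: contraNneq u0 => ->.
  - by move: Hu; rewrite /= mulmx0 addr0.
have [[_ kU] _] := uncoupledP HC V; split.
- move=> c; rewrite (_ : series _ = fun=> 0); first exact: is_cvg_cst.
  apply/funext => n; apply: big1 => k _.
  by rewrite /= mxE /= !expr0n addr0 sqrtr0 expr0n.
- by apply: contraNneq u0 => -[->].
- congr (_, _); first by rewrite /= mulmx0 addr0.
  by apply/funext => -[|n] /=; rewrite ?kU // !scaler0 ?add0r ?addr0 ?scaler0.
Qed.

(** By [core_eigenvectorE], core-supported eigenvectors are the nonzero kernel vectors of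
    [H_0 - lambda]. *)
Lemma core_eigenvalueE (lambda : R[i]) :
  core_eigenvalue q HC V lambda <-> lfdet (H_0 HC V - lambda *: \1%VF) = 0.
Proof.
have [[iU _] _] := uncoupledP HC V.
have minusE u : (H_0 HC V - lambda *: \1%VF) u = H_0 HC V u - lambda *: u.
  by rewrite add_lfunE opp_lfunE scale_lfunE id_lfunE.
split=> [[[u g] [+ g0]]|/eqP/lfdet_eq0P[u u0]].
  rewrite [g]g0 => /core_eigenvectorE[uU u0 Hu]; apply/eqP/lfdet_eq0P.
  exists (vsproj (uncoupled HC V) u).
    by apply: contraNneq u0 => /(congr1 vsval); rewrite vsprojK // => ->.
  apply/subvs_inj; rewrite minusE linearB linearZ /= scalerN restr_endE //.
  by rewrite vsprojK // Hu subrr.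
rewrite minusE => /(congr1 vsval).
rewrite linearB linearZ /= scalerN restr_endE //.
move=> /eqP; rewrite subr_eq0 => /eqP Hu; exists (vsval u, 0); split=> //.
by apply/core_eigenvectorE; rewrite subvsP.
Qed.

Lemma linspan_core_eigenvectors : HC = HC^t* ->
  [set psi : 'cV[R[i]]_d * (nat -> 'cV[R[i]]_r) |
    psi.1 \in uncoupled HC V /\ psi.2 = 0]
  = linspan (core_eigenvectors q HC V).
Proof.
move=> hHC; have [[iU _] _] := uncoupledP HC V.
apply/seteqP; split=> [[u g] /= [uU ->]|_ [n [c [w [wP ->]]]]] /=.
  have [n [c [w [wP ->]]]] := hermitian_eigenspan (esym hHC) iU uU.
  exists n, c, (fun i => (w i, 0)); split=> [i|].
    have [wU w0 [l Hw]] := wP i; split=> //; exists l.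
    exact/core_eigenvectorE.
  apply: injective_projections; rewrite raddf_sum //= big1 // => i _.
  by rewrite scaler0.
rewrite !raddf_sum /=; split.
  apply: memv_suml => i _; apply: memvZ; have [[l]] := wP i.
  by case: (w i) => u g + g0; rewrite [g]g0 => /core_eigenvectorE[].
by apply: big1 => i _; have [_ ->] := wP i; rewrite scaler0.
Qed.

End Model.

Theorem theorem3p2 (R : realType) (q d r : nat)
    (HC : 'M[R[i]]_d) (V : 'M[R[i]]_(d, r))
    (q_prime_power : prime_power q) (d_ge1 : (1 <= d)%N) (r_ge1 : (1 <= r)%N)
    (HC_hermitian : HC = HC^t*) :
  [/\ (* core-supported eigenvectors span the vectors (u, 0), u in H_0 *)
      [set psi : 'cV[R[i]]_d * (nat -> 'cV[R[i]]_r) | psi.1 \in uncoupled HC V /\ psi.2 = 0]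
        = linspan (core_eigenvectors q HC V),
      (* F is the direct sum of H_0 - x I and F_coupled *)
      forall zeta : R[i], zeta != 0 ->
      forall (u : subvs_of (uncoupled HC V))
             (w : subvs_of (orthov (uncoupled HC V))),
        Fmat q HC V zeta *m (vsval u + vsval w)
        = vsval (H_0_minus q HC V zeta u) + vsval (F_coupled q HC V zeta w),
      (* the identity of meromorphic functions on C^* for det S *)
      finite_set [set zeta : R[i] | zeta != 0 /\ Fmat q HC V zeta \notin unitmx] /\
      (forall zeta : R[i], zeta != 0 -> Fmat q HC V zeta \in unitmx ->
         lfdet (F_coupled q HC V zeta) != 0 /\
         \det (Smat q HC V zeta)
         = (-1) ^+ r * (lfdet (F_coupled q HC V zeta^-1)
                        / lfdet (F_coupled q HC V zeta))) &
      (* contribution and cancellation of the core-supported eigenvalues *)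
      [/\ forall lambda : R[i],
            core_eigenvalue q HC V lambda <->
            lfdet (H_0 HC V - lambda *: \1%VF) = 0,
          forall zeta : R[i], zeta != 0 ->
            \det (Fmat q HC V zeta)
            = lfdet (H_0_minus q HC V zeta) * lfdet (F_coupled q HC V zeta),
          forall zeta : R[i], zeta != 0 ->
            lfdet (H_0_minus q HC V zeta^-1) = lfdet (H_0_minus q HC V zeta) &
          forall zeta : R[i], zeta != 0 -> Fmat q HC V zeta \in unitmx ->
            \det (Smat q HC V zeta)
            = (-1) ^+ r * (\det (Fmat q HC V zeta^-1) / \det (Fmat q HC V zeta))
            /\ \det (Fmat q HC V zeta^-1) / \det (Fmat q HC V zeta)
               = lfdet (F_coupled q HC V zeta^-1)
                 / lfdet (F_coupled q HC V zeta)]].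
Proof.
have hop0 : hop R q != 0 by exact: hop_neq0.
have F0 zeta : Fmat q HC V zeta \in unitmx ->
    lfdet (H_0_minus q HC V zeta) != 0 /\ lfdet (F_coupled q HC V zeta) != 0.
  by rewrite unitmxE unitfE det_Fmat // mulf_eq0 negb_or => /andP.
have H_0_minusV zeta :
    lfdet (H_0_minus q HC V zeta^-1) = lfdet (H_0_minus q HC V zeta).
  by rewrite /H_0_minus xmapV.
have ratioE zeta : Fmat q HC V zeta \in unitmx ->
    \det (Fmat q HC V zeta^-1) / \det (Fmat q HC V zeta)
    = lfdet (F_coupled q HC V zeta^-1) / lfdet (F_coupled q HC V zeta).
  (* The two [H_0] factors agree and are nonzero because [Fmat] is invertible at [zeta]; at
     [zeta^-1] it may be singular. *)
  move=> /F0[H0 _]; rewrite !det_Fmat // H_0_minusV.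
  by rewrite -mulf_div divff // mul1r.
split.
- exact: linspan_core_eigenvectors.
- by move=> zeta _ u w; rewrite mulmxDr H_0_minusE F_coupledE.
- split; first exact: finite_singular_Fmat.
  by move=> zeta z0 uF; rewrite det_Smat // ratioE //; case: (F0 _ uF).
- split=> [lambda|zeta _|zeta _|zeta z0 uF].
  + exact: core_eigenvalueE.
  + exact: det_Fmat.
  + exact: H_0_minusV.
  + by rewrite det_Smat // ratioE.
Qed.
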